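(* Let $n>40000$ be an integer and let $G$ be a graph of order $n$ such that $K_{2,3}$ is not a minor of $G$. Then $\mu(G)<\mu(F_3(n))$, unless $G=F_3(n)$ (up to isomorphism).
   Context: Graphs are finite, simple and undirected; the order of a graph is its number of vertices. A graph $H$ is a minor of a graph $G$ if $H$ can be obtained by contracting edges of a subgraph of $G$. $K_{a,b}$ is the complete bipartite graph with parts of sizes $a$ and $b$, and $K_m$ is the complete graph on $m$ vertices. The spectral radius $\mu(G)$ is the largest eigenvalue of the adjacency matrix of $G$. For graphs $F$ and $H$, $F\vee H$ denotes their join, $F+H$ their disjoint union, and $pH$ the disjoint union of $p$ copies of $H$. The graph $F_3(n)$, for $n\geq 4$: set $p=\lfloor (n-1)/3\rfloor$ and write $n-1=3p+s$ with $0\leq s\leq 2$; then $F_3(n):=K_1\vee(pK_3+K_s)$, where for $s=0$ this means $F_3(n):=K_1\vee pK_3$. *)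

(* Defs.v *)
From HB Require Import structures.
From mathcomp Require Import all_boot all_order all_algebra.
From mathcomp Require Import classical_sets reals.

Set Implicit Arguments.
Unset Strict Implicit.
Unset Printing Implicit Defensive.

Import Order.TTheory GRing.Theory Num.Theory.

(* Finite simple undirected graphs. The empty graph is allowed. *)
Record sgraph := SGraph {
  vertex :> finType;
  adj : rel vertex;
  adj_sym : symmetric adj;
  adj_irr : irreflexive adj }.

Definition isomorphic (G H : sgraph) : Prop :=
  exists2 f : G -> H, bijective f & {mono f : x y / adj x y}.

(* S is (up to isomorphism) a not necessarily induced subgraph of G. *)
Definition subgraph (S G : sgraph) : Prop :=
  exists2 f : S -> G, injective f & {homo f : x y / adj x y}.

Section Contract.
Variables (G : sgraph) (u v : G).

(* Contraction of u and v: v is deleted and u, which stands for the merged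
   vertex, inherits the neighbours of v. The condition x != y discards the
   loop coming from the edge uv; parallel edges are merged. *)
Definition contract_adj (x y : {x : G | x != v}) : bool :=
  (x != y) && [|| adj (val x) (val y),
                  (val x == u) && adj v (val y) |
                  (val y == u) && adj v (val x)].

Lemma contract_adj_sym : symmetric contract_adj.
Proof.
move=> x y; rewrite /contract_adj eq_sym (adj_sym (val x) (val y)).
by congr (_ && (_ || _)); rewrite orbC.
Qed.

Lemma contract_adj_irr : irreflexive contract_adj.
Proof. by move=> x; rewrite /contract_adj eqxx. Qed.

Definition contract : sgraph := SGraph contract_adj_sym contract_adj_irr.

End Contract.

Inductive contracts_to (H : sgraph) : sgraph -> Prop :=
| ContractsIso (G : sgraph) : isomorphic G H -> contracts_to H G
| ContractsEdge (G : sgraph) (u v : G) :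
    adj u v -> contracts_to H (contract u v) -> contracts_to H G.

Definition minor (H G : sgraph) : Prop :=
  exists2 S : sgraph, subgraph S G & contracts_to H S.

Definition complete_adj (m : nat) : rel 'I_m := fun x y => x != y.

Lemma complete_adj_sym m : symmetric (@complete_adj m).
Proof. by move=> x y; rewrite /complete_adj eq_sym. Qed.

Lemma complete_adj_irr m : irreflexive (@complete_adj m).
Proof. by move=> x; rewrite /complete_adj eqxx. Qed.

Definition complete (m : nat) : sgraph :=
  SGraph (@complete_adj_sym m) (@complete_adj_irr m).

Definition bipartite_adj (a b : nat) : rel ('I_a + 'I_b)%type :=
  fun x y => match x, y with
             | inl _, inr _ | inr _, inl _ => true
             | _, _ => false
             end.

Lemma bipartite_adj_sym a b : symmetric (@bipartite_adj a b).
Proof. by case=> x [] y. Qed.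

Lemma bipartite_adj_irr a b : irreflexive (@bipartite_adj a b).
Proof. by case. Qed.

Definition complete_bipartite (a b : nat) : sgraph :=
  SGraph (@bipartite_adj_sym a b) (@bipartite_adj_irr a b).

(* The graph on the disjoint sum of the vertex sets of F and H in which all
   (if c) or none (if ~~ c) of the pairs between F and H are adjacent. *)
Definition sum_adj (c : bool) (F H : sgraph) : rel (F + H)%type :=
  fun x y => match x, y with
             | inl x, inl y => adj x y
             | inr x, inr y => adj x y
             | _, _ => c
             end.

Lemma sum_adj_sym c F H : symmetric (@sum_adj c F H).
Proof. by case=> x [] y //=; rewrite adj_sym. Qed.

Lemma sum_adj_irr c F H : irreflexive (@sum_adj c F H).
Proof. by case=> x /=; rewrite adj_irr. Qed.

Definition graph_join (F H : sgraph) : sgraph :=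
  SGraph (@sum_adj_sym true F H) (@sum_adj_irr true F H).

Definition disjoint_union (F H : sgraph) : sgraph :=
  SGraph (@sum_adj_sym false F H) (@sum_adj_irr false F H).

Definition copies_adj (p : nat) (H : sgraph) : rel ('I_p * H)%type :=
  fun x y => (x.1 == y.1) && adj x.2 y.2.

Lemma copies_adj_sym p H : symmetric (@copies_adj p H).
Proof. by move=> x y; rewrite /copies_adj eq_sym adj_sym. Qed.

Lemma copies_adj_irr p H : irreflexive (@copies_adj p H).
Proof. by move=> x; rewrite /copies_adj adj_irr andbF. Qed.

Definition copies (p : nat) (H : sgraph) : sgraph :=
  SGraph (@copies_adj_sym p H) (@copies_adj_irr p H).

(* For n = 1 mod 3 the summand complete 0 is the empty graph, so that F3 n is
   the join of K_1 with p copies of K_3. *)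
Definition F3 (n : nat) : sgraph :=
  let p := (n.-1 %/ 3)%N in
  let s := (n.-1 %% 3)%N in
  graph_join (complete 1) (disjoint_union (copies p (complete 3)) (complete s)).

Local Open Scope ring_scope.
Local Open Scope classical_set_scope.

Definition adjmx (R : realType) (G : sgraph) : 'M[R]_#|G| :=
  \matrix_(i, j) (adj (enum_val i) (enum_val j))%:R.

(* The set of eigenvalues of a symmetric real matrix of positive size is finite
   and nonempty, so for a graph with a vertex this supremum is a maximum. *)
Definition spectral_radius (R : realType) (G : sgraph) : R :=
  sup [set a : R | eigenvalue (adjmx R G) a].

(* Main.v *)
(* F3 n has an eigenvalue l >= 200 with l (l - 2) >= n - 1 - 2 / (l - 1).  Suppose
   that G has an eigenvalue >= l and take the absolute value x of an eigenvector, scaled so that its maximum is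
   x u = 1; then A x >= l x.

   Two vertices have at most two common neighbours.  As this persists under
   contractions, contracting an edge destroys at most three edges, so G has at
   most 3 (n - 1) edges and l * sum x <= 6 (n - 1).  Counting 2-walks from u gives
   l^2 <= deg u + 2 (sum x - 1), so u has only m = O(l) non-neighbours, every
   other vertex has degree O(l), and the same count from v <> u shows that x v is
   small.  Summing A x >= l x over the neighbours of u then gives
   l (l - 2) <= n - 1 - m + 2 * (sum of x over the non-neighbours), hence m = 0.

   Now H = G - u has maximum degree at most 2.  Let y solve (l - A_H) y = 1.  By
   the maximum principle x <= y on H, so l <= sum y, that is,
   sum (2 - deg v) y v <= 2 / (l - 1).  Since y v >= 1 / l, with better bounds at
   vertices of degree 1, and the sum of the 2 - deg v is even, H is 2-regular up to
   an isolated vertex or an isolated edge.  The 2-regular part consists of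
   triangles, because u together with a longer cycle contracts to a wheel, which
   has a K_{2,3} minor; hence G = F3 n. *)
Require Import Defs.
From mathcomp Require Import all_boot all_order all_algebra.
From mathcomp Require Import zify ring lra.

Set Implicit Arguments.
Unset Strict Implicit.
Unset Printing Implicit Defensive.

(** * Minor models *)

(** A path in this relation never leaves a fibre of [f], so [connect] expresses connectivity of the
    fibres. *)
Definition fiber_adj (G : sgraph) (T : eqType) (f : G -> T) : rel G :=
  fun x y => adj x y && (f x == f y).

(** The branch-set form of minors: the fibres over [Some a] are the branch sets, and the vertices
    sent to [None] are deleted. Since the theorem assumes the absence of a minor, the implication
    from models to [minor] suffices. *)
Definition minor_model (H G : sgraph) : Prop :=
  exists phi : G -> option H,
  [/\ forall a, exists x, phi x = Some a,
      forall x y, phi x -> phi x = phi y -> connect (fiber_adj phi) x y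
    & forall a b, adj a b ->
        exists x y, [/\ phi x = Some a, phi y = Some b & adj x y]].

Lemma connect_homo (T T' : finType) (e : rel T) (e' : rel T') (f : T -> T') :
  (forall x y, e x y -> connect e' (f x) (f y)) ->
  forall x y, connect e x y -> connect e' (f x) (f y).
Proof.
move=> h x y /connectP[p + ->] {y}; elim: p x => [|z p IH] x /=.
  by rewrite connect0.
by move=> /andP[/h xz /IH]; apply: connect_trans.
Qed.

Section Merge.
Variables (G : sgraph) (u v : G).
Hypothesis uv : adj u v.

Lemma adj_neq : u != v.
Proof. by apply: contraL uv => /eqP->; rewrite adj_irr. Qed.

Lemma merge_subproof x : (if x == v then u else x) != v.
Proof. by case: (eqVneq x v) => // _; exact: adj_neq. Qed.

Definition merge (x : G) : contract u v :=
  exist (fun z => z != v) _ (merge_subproof x).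

Lemma val_merge x : val (merge x) = if x == v then u else x.
Proof. by []. Qed.

Lemma mergeK (x : contract u v) : merge (val x) = x.
Proof. by apply: val_inj; rewrite val_merge (negPf (valP x)). Qed.

Lemma adj_merge x y : adj x y -> merge x != merge y -> adj (merge x) (merge y).
Proof.
move=> xy nxy; rewrite /= /contract_adj nxy /=.
move: nxy; rewrite -val_eqE /= => _.
case: (eqVneq x v) xy => [->|nxv]; case: (eqVneq y v) => [->|nyv] /= xy.
- by rewrite adj_irr in xy.
- by rewrite eqxx xy orbT.
- by rewrite eqxx (adj_sym v x) xy !orbT.
- by rewrite xy.
Qed.

Lemma contract_adjP (x y : contract u v) : adj x y ->
  exists x' y', [/\ merge x' = x, merge y' = y & adj x' y'].
Proof.
case/andP=> _ /or3P[xy|/andP[/eqP xu vy]|/andP[/eqP yu vx]].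
- by exists (val x), (val y); rewrite !mergeK.
- exists v, (val y); rewrite mergeK vy; split=> //.
  by apply: val_inj; rewrite val_merge eqxx xu.
- exists (val x), v; rewrite mergeK adj_sym vx; split=> //.
  by apply: val_inj; rewrite val_merge eqxx yu.
Qed.

(** Distinct vertices with the same image are [u] and [v], which are adjacent. *)
Lemma connect_merge (T : eqType) (g : contract u v -> T) (x y : G) :
  merge x = merge y -> connect (fiber_adj (g \o merge)) x y.
Proof.
move=> e; have ge : g (merge x) == g (merge y) by rewrite e.
have [->|nxy] := eqVneq x y; first exact: connect0.
apply: connect1; rewrite /fiber_adj /= ge andbT.
move/(congr1 val): e nxy; rewrite !val_merge.
case: (eqVneq x v) => [->|_]; case: (eqVneq y v) => [->|_] e nxy.
- by [].
- by rewrite -e adj_sym.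
- by rewrite e.
- by rewrite e eqxx in nxy.
Qed.

End Merge.

(** Induction on the number of vertices. If [f] is injective, it is an isomorphism; otherwise some
    connected fibre has two vertices, hence contains an edge, and [f] factors through the
    contraction of that edge. *)
Lemma contracts_to_fibers (H S : sgraph) (f : S -> H) :
  (forall a, exists x, f x = a) ->
  (forall x y, f x = f y -> connect (fiber_adj f) x y) ->
  (forall x y, adj x y -> f x = f y \/ adj (f x) (f y)) ->
  (forall a b, adj a b -> exists x y, [/\ f x = a, f y = b & adj x y]) ->
  contracts_to H S.
Proof.
have [k] := ubnP #|S|; elim: k S f => // k IH S f; rewrite ltnS => leSk.
move=> fsurj fconn fhomo fadj.
have [finj|/injectivePn[x [y nxy fxy]]] := boolP (injectiveb f).
  have {}finj := injectiveP _ finj.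
  apply: ContractsIso; exists f => [|x y].
    have h a : exists x, f x == a by have [x <-] := fsurj a; exists x.
    exists (fun a => xchoose (h a)) => [x|a]; last exact/eqP/(xchooseP (h a)).
    exact/finj/eqP/(xchooseP (h (f x))).
  apply/idP/idP=> [/fadj[x' [y' [/finj<- /finj<-]]] //|xy].
  by case: (fhomo _ _ xy) => [/finj exy|//]; rewrite exy adj_irr in xy.
have [u [v [uv fuv]]] : exists u v : S, adj u v /\ f u = f v.
  case/connectP: (fconn x y fxy) => -[/= _ exy|z p /=]; first by rewrite exy eqxx in nxy.
  by case/andP=> /andP[xz /eqP fxz] _ _; exists x, z.
apply: (@ContractsEdge _ _ u v uv).
pose g (x : contract u v) := f (val x).
have gm x0 : g (merge uv x0) = f x0.
  by rewrite /g val_merge; case: eqP => [->|].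
apply: (IH _ g).
- by apply: leq_trans leSk; rewrite card_sub cardC1 prednK //; apply/card_gt0P; exists u.
- by move=> a; have [x0 <-] := fsurj a; exists (merge uv x0); rewrite gm.
- move=> x0 y0 /fconn; rewrite -{2}(mergeK uv x0) -{2}(mergeK uv y0).
  apply: connect_homo => x1 y1 /andP[adj1 f1].
  have [->|n1] := eqVneq (merge uv x1) (merge uv y1); first by rewrite connect0.
  by apply: connect1; rewrite /fiber_adj adj_merge //= !gm.
- move=> x0 y0 /(contract_adjP uv)[x1 [y1 [<- <- /fhomo]]].
  by rewrite !gm.
- move=> a b /[dup] ab /fadj[x0 [y0 [fa fb xy]]].
  exists (merge uv x0), (merge uv y0); rewrite !gm fa fb; split=> //.
  apply: adj_merge => //; apply: contraTneq ab => /(congr1 g).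
  by rewrite !gm fa fb => ->; rewrite adj_irr.
Qed.

Lemma minor_model_minor (H G : sgraph) : minor_model H G -> minor H G.
Proof.
case=> phi [surj conn adjm].
pose V := {x : G | phi x}.
have hf (x : V) : exists a, phi (val x) == Some a.
  by case: x => x /=; case: (phi x) => // a _; exists a.
pose f (x : V) : H := xchoose (hf x).
have fE x : phi (val x) = Some (f x) by apply/eqP/(xchooseP (hf x)).
have lift x a : phi x = Some a -> exists2 x' : V, val x' = x & f x' = a.
  move=> e; have px : phi x by rewrite e.
  by exists (exist (fun z => phi z) x px) => //; apply: Some_inj; rewrite -fE.
(* Edges between branch sets that are not adjacent in [H] are dropped, because contraction has to
   end exactly in [H]. *)
pose r : rel V := fun x y =>
  adj (val x) (val y) && ((f x == f y) || adj (f x) (f y)).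
have r_sym : symmetric r.
  by move=> x y; rewrite /r adj_sym eq_sym (adj_sym (f x)).
have r_irr : irreflexive r by move=> x; rewrite /r adj_irr.
exists (SGraph r_sym r_irr).
  exists val; first exact: val_inj.
  by move=> x y /andP[].
apply: (@contracts_to_fibers _ (SGraph r_sym r_irr) f).
- by move=> a; have [x /lift[x' _ <-]] := surj a; exists x'.
- move=> x y fxy.
  have pxy : phi (val x) = phi (val y) by rewrite !fE fxy.
  (* All vertices outside [V] go to the default [x], so an edge between two of them becomes a
     trivial path. *)
  pose g (z : G) : V := insubd x z.
  have := conn _ _ (valP x) pxy.
  rewrite -{2}[x](valKd x) -{2}[y](valKd x).
  apply: connect_homo => z w /andP[zw /eqP pzw].
  have [pz|npz] := boolP (phi z : bool); last first.
    rewrite /insubd !insubF ?connect0 //; apply/negbTE => //.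
    by rewrite -pzw.
  have pw : phi w by rewrite -pzw.
  have vz : val (insubd x z) = z by rewrite insubdK.
  have vw : val (insubd x w) = w by rewrite insubdK.
  apply: connect1; rewrite /fiber_adj /= /r vz vw zw /=.
  suff -> : f (insubd x z) = f (insubd x w) by rewrite eqxx.
  by apply: Some_inj; rewrite -!fE vz vw.
- by move=> x y /andP[_ /orP[/eqP|]]; auto.
- move=> a b /[dup] ab /adjm[x [y [/lift[x' <- fx] /lift[y' <- fy] xy]]].
  by exists x', y'; split=> //=; rewrite /r xy fx fy ab orbT.
Qed.

(** The branch sets are pulled back along [merge]. A path in the contraction lifts edge by edge, and
    the two lifts of an intermediate vertex are joined by [connect_merge]. *)
Lemma minor_model_contract (H G : sgraph) (u v : G) : adj u v ->
  minor_model H (contract u v) -> minor_model H G.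
Proof.
move=> uv [phi [surj conn adjm]].
exists (phi \o merge uv); split=> /=.
- by move=> a; have [x e] := surj a; exists (val x); rewrite mergeK.
- suff h (x y : contract u v) x' y' : merge uv x' = x -> merge uv y' = y ->
     phi x -> connect (fiber_adj phi) x y ->
     connect (fiber_adj (phi \o merge uv)) x' y'.
    by move=> x y px pxy; apply: (h (merge uv x) (merge uv y)); rewrite ?conn.
  move=> ex ey px /connectP[p]; elim: p x x' ex px => [|z p IH] x x' ex px /=.
    by move=> _ yx; apply: connect_merge; rewrite ex ey yx.
  case/andP=> /andP[/(contract_adjP uv)[x1 [z1 [ex1 ez1 xz1]]] /eqP fxz] pz yz.
  have pz' : phi z by rewrite -fxz.
  have h1 : connect (fiber_adj (phi \o merge uv)) z1 y' by apply: IH pz yz.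
  have h2 : connect (fiber_adj (phi \o merge uv)) x1 z1.
    by apply: connect1; rewrite /fiber_adj xz1 /= ex1 ez1 fxz.
  apply: connect_trans (connect_trans h2 h1).
  by apply: connect_merge; rewrite ex ex1.
- move=> a b /adjm[x [y [fx fy /(contract_adjP uv)[x' [y' [ex ey xy]]]]]].
  by exists x', y'; rewrite ex ey.
Qed.

(** * Graphs without a K_{2,3} minor *)

Notation K23 := (complete_bipartite 2 3).

Definition deg (G : sgraph) (v : G) : nat := #|[pred w | adj v w]|.

Section K23.
Variable G : sgraph.

Definition codeg (x y : G) : nat := #|[pred z | adj x z & adj z y]|.

(** The part of size 2 is modelled by [v] and the connected set [R], the part of size 3 by single
    vertices. [R] will be either one vertex or a path of a cycle. *)
Lemma K23_modelI (v b0 b1 b2 : G) (R : {set G}) :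
  uniq [:: v; b0; b1; b2] ->
  (forall x, x \in [:: v; b0; b1; b2] -> x \notin R) ->
  (forall b, b \in [:: b0; b1; b2] -> adj v b) ->
  (forall b, b \in [:: b0; b1; b2] -> exists2 r, r \in R & adj r b) ->
  (forall x y, x \in R -> y \in R ->
     connect (fun x y => [&& adj x y, x \in R & y \in R]) x y) ->
  minor_model K23 G.
Proof.
move=> U nR av aR conn.
pose bs := [:: b0; b1; b2].
pose phi (z : G) : option K23 :=
  if z == v then Some (inl ord0)
  else if z \in R then Some (inl ord_max)
  else if z \in bs then Some (inr (inord (index z bs))) else None.
have phiv : phi v = Some (inl ord0) by rewrite /phi eqxx.
have phiR z : z \in R -> phi z = Some (inl ord_max).
  move=> zR; rewrite /phi zR; case: eqP => // zv.
  by have := nR v; rewrite inE eqxx -zv zR => /(_ isT).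
have Ub : uniq bs by case/andP: U.
have vbs : v \notin bs by case/andP: U.
have phib z : z \in bs -> phi z = Some (inr (inord (index z bs))).
  move=> zb; rewrite /phi zb; case: eqP => [zv|_]; first by rewrite -zv zb in vbs.
  by rewrite (negPf (nR z _)) // inE zb orbT.
have bsK z : z \in bs -> nth v bs (inord (index z bs) : 'I_3) = z.
  by move=> zb; rewrite inordK ?nth_index // -/(size bs) index_mem.
have phibn (i : 'I_3) : phi (nth v bs i) = Some (inr i).
  rewrite phib ?mem_nth ?index_uniq //; congr (Some (inr _)).
  by apply: val_inj; rewrite /= inordK.
have phi_inv z : phi z ->
    [\/ z = v, z \in R | (z \in bs) && (z \notin R)].
  rewrite /phi; case: eqP => [->|_]; first by constructor 1.
  case: ifP => [zR|_]; first by constructor 2.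
  by case: ifP => // zb; constructor 3.
have two (i : 'I_2) : i = ord0 \/ i = ord_max.
  by case: i => [[|[|//]] ?]; [left|right]; apply: val_inj.
have [r0 r0R _] : exists2 r, r \in R & adj r b0 by apply: aR; rewrite inE eqxx.
have key (i : 'I_2) (j : 'I_3) :
    exists x y, [/\ phi x = Some (inl i), phi y = Some (inr j) & adj x y].
  have jb : nth v bs j \in bs by rewrite mem_nth.
  case: (two i) => ->.
    by exists v, (nth v bs j); rewrite phibn phiv av.
  have [r rR arj] := aR _ jb.
  by exists r, (nth v bs j); rewrite phibn phiR.
exists phi; split.
- case=> [i|i]; last by exists (nth v bs i).
  by case: (two i) => ->; [exists v | exists r0; apply: phiR].
- move=> x y /phi_inv[->|xR|/andP[xb xR]] exy.
  + have /phi_inv[->|yR|/andP[yb yR]] : phi y by rewrite -exy phiv.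
    * exact: connect0.
    * by rewrite phiv phiR in exy.
    * by rewrite phiv phib in exy.
  + have /phi_inv[yv|yR|/andP[yb yR]] : phi y by rewrite -exy phiR.
    * by rewrite yv phiv phiR in exy.
    * apply: connect_sub (conn _ _ xR yR) => z w /and3P[zw zR wR].
      by apply: connect1; rewrite /fiber_adj zw !phiR /=.
    * by rewrite phiR // phib in exy.
  + have /phi_inv[yv|yR|/andP[yb yR]] : phi y by rewrite -exy phib.
    * by rewrite yv phiv phib in exy.
    * by rewrite phib // phiR in exy.
    * move: exy; rewrite !phib // => -[exy].
      by rewrite -(bsK _ xb) exy bsK // connect0.
- case=> [i|i] [j|j] // _.
  by have [x [y [px py xy]]] := key j i; exists y, x; rewrite adj_sym.
Qed.

(** Three common neighbours would span a $K_{2,3}$ together with [x] and [y]. *)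
Lemma codeg_le2 (x y : G) : ~ minor_model K23 G -> x != y -> codeg x y <= 2.
Proof.
move=> free nxy; rewrite leqNgt; apply/negP => /card_gt2P[b0 [b1 [b2]]].
rewrite !inE => -[[/andP[x0 y0] /andP[x1 y1] /andP[x2 y2]] [n01 n12 n20]].
have nx z : adj x z -> x != z by exact: adj_neq.
have ny z : adj z y -> z != y by exact: adj_neq.
apply: free; apply: (@K23_modelI x b0 b1 b2 [set y]).
- by rewrite /= !inE !negb_or !nx // n01 n12 eq_sym n20.
- by move=> z; rewrite !inE => /or4P[] /eqP-> //; apply: ny.
- by move=> z; rewrite !inE => /or3P[] /eqP->.
- by move=> z; rewrite !inE => /or3P[] /eqP->; exists y; rewrite ?inE // adj_sym.
- by move=> z w /set1P-> /set1P->; rewrite connect0.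
Qed.

End K23.

(** * The number of edges *)

(** Twice the number of edges. *)
Definition arcs (G : sgraph) : nat := \sum_(x : G) \sum_(y : G) adj x y.

Lemma sum_sub_neq (T : finType) (A : nmodType) (v : T) (F : T -> A) :
  (\sum_(x | x != v) F x = \sum_(x : {x : T | x != v}) F (val x))%R.
Proof.
rewrite (reindex_omap (val : {x : T | x != v} -> T) insub) /=; last first.
  by move=> x nx; rewrite insubT.
by apply: eq_bigl => x; rewrite (valP x) valK eqxx.
Qed.


(** Contraction loses the edge [uv] and, for each common neighbour, one of two edges that become
    parallel; each loss counts for two arcs. *)
Lemma arcs_contract (G : sgraph) (u v : G) : adj u v ->
  arcs G <= arcs (contract u v) + 2 + 2 * codeg u v.
Proof.
move=> uv; have nuv := adj_neq uv.
pose c x := (x != u) && adj v x && ~~ adj u x.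
(* [D] counts the arcs that avoid [v], and [N] the vertices that become new neighbours of [u]. *)
pose D := \sum_(x | x != v) \sum_(y | y != v) adj x y.
pose N := \sum_(x | x != v) c x.
have -> : arcs G = D + 2 * \sum_(x | x != v) adj v x.
  rewrite /arcs (bigD1 v) //= (bigD1 v) //= adj_irr add0n.
  have -> : \sum_(x | x != v) \sum_(y : G) adj x y =
      \sum_(x | x != v) (adj v x + \sum_(y | y != v) adj x y).
    by apply: eq_bigr => x _; rewrite (bigD1 v) //= adj_sym.
  by rewrite big_split /= -/D addnA addnn -mul2n addnC.
have -> : arcs (contract u v) = D + 2 * N.
  rewrite /arcs.
  pose F x y := (x != y) && [|| adj x y, (x == u) && adj v y | (y == u) && adj v x].
  have -> : \sum_(x : contract u v) \sum_(y : contract u v) adj x y =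
      \sum_(x | x != v) \sum_(y | y != v) F x y.
    rewrite (@sum_sub_neq _ nat v (fun x => \sum_(y | y != v) F x y)).
    by apply: eq_bigr => x _; rewrite (@sum_sub_neq _ nat v).
  have FE x y : (F x y : nat) = adj x y + (x == u) * c y + (y == u) * c x.
    rewrite /F /c; case: (eqVneq x y) => [<-|nxy].
      by rewrite adj_irr; case: eqP.
    case: (eqVneq x u) nxy => [->|_]; case: (eqVneq y u) => [->|_] //= _.
    - by case: (adj u y) => //=; case: (adj v y).
    - by rewrite (adj_sym x); case: (adj u x) => //=; case: (adj v x).
    - by rewrite !orbF !addn0.
  under eq_bigr do under eq_bigr do rewrite FE.
  under eq_bigr do rewrite !big_split /= -/N -big_distrr /= -big_distrl /=.
  rewrite !big_split /= -/D -big_distrl -big_distrr /= -/N.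
  have -> : \sum_(x | x != v) (x == u) = 1.
    by rewrite (bigD1 u) //= eqxx big1 // => x /andP[_ /negPf->].
  by rewrite mul1n -addnA addnn mul2n.
have -> : \sum_(x | x != v) adj v x = 1 + codeg u v + N.
  have -> : N = \sum_(x | (x != v) && (x != u)) c x.
    by rewrite /N (bigD1 u) //= {1}/c eqxx add0n.
  have -> : codeg u v = \sum_(x | (x != v) && (x != u)) (adj u x && adj x v).
    rewrite /codeg -sum1_card big_mkcond /= (bigD1 v) //= inE adj_irr andbF add0n.
    rewrite (bigD1 u) //= inE adj_irr add0n; apply: eq_bigr => x _.
    by rewrite inE; case: ifP.
  rewrite (bigD1 u) //= adj_sym uv -addnA -big_split /=; congr (_ + _).
  apply: eq_bigr => x /andP[nxv nxu].
  by rewrite /c nxu (adj_sym x); case: (adj u x); case: (adj v x).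
by rewrite !mulnDr; lia.
Qed.

(** Each contraction removes one vertex and at most 2 + 2 * 2 = 6 arcs, and creates no $K_{2,3}$
    model. *)
Lemma arcs_bound (G : sgraph) : ~ minor_model K23 G -> arcs G <= 6 * #|G|.-1.
Proof.
have [k] := ubnP #|G|; elim: k G => // k IH G; rewrite ltnS => leGk free.
have [/existsP[u /existsP[v uv]]|no] := boolP [exists u : G, exists v : G, adj u v].
  apply: leq_trans (arcs_contract uv) _.
  have := codeg_le2 free (adj_neq uv).
  have cc : #|contract u v| = #|G|.-1 by rewrite card_sub cardC1.
  have n0 : 1 < #|G| by apply/card_gt1P; exists u, v; split=> //; apply: adj_neq.
  have /IH : #|contract u v| < k by rewrite cc; lia.
  rewrite cc => /(_ (fun m => free (minor_model_contract uv m))).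
  lia.
rewrite /arcs big1 // => u _; rewrite big1 // => v _.
case uv: (adj u v) => //; case/existsP: no; exists u; by apply/existsP; exists v.
Qed.

(** * K_{2,3}-minor-free graphs with a dominating vertex *)

(** Orienting each edge by [enum_rank] splits the double sum into two equal halves. The predicate
    [P] allows induced subgraphs. *)
Lemma handshake (G : sgraph) (P : pred G) :
  ~~ odd (\sum_(v | P v) \sum_(w | P w) adj v w).
Proof.
pose F (v w : G) := (adj v w && (enum_rank v < enum_rank w)) : nat.
have FE v w : (adj v w : nat) = F v w + F w v.
  rewrite /F (adj_sym w); case vw: (adj v w) => //=.
  have := adj_neq vw; rewrite -(inj_eq enum_rank_inj) -val_eqE /=.
  by case: ltngtP.
under eq_bigr do under eq_bigr do rewrite FE.
under eq_bigr do rewrite big_split /=.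
by rewrite big_split /= [X in _ + X]exchange_big /= addnn odd_double.
Qed.

Lemma deg2_nbr (G : sgraph) (v a b z : G) : (deg v <= 2)%N ->
  adj v a -> adj v b -> a != b -> adj v z -> z = a \/ z = b.
Proof.
move=> d2 va vb nab vz.
have [->|nza] := eqVneq z a; first by left.
have [->|nzb] := eqVneq z b; first by right.
suff : (2 < deg v)%N by rewrite ltnNge d2.
by apply/card_gt2P; exists a, b, z; rewrite !inE va vb vz nab nza eq_sym nzb.
Qed.

Section DeleteVertex.
Variables (G : sgraph) (u : G).

Definition delete_adj : rel {x : G | x != u} := fun x y => adj (val x) (val y).

Lemma delete_adj_sym : symmetric delete_adj.
Proof. by move=> x y; rewrite /delete_adj adj_sym. Qed.

Lemma delete_adj_irr : irreflexive delete_adj.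
Proof. by move=> x; rewrite /delete_adj adj_irr. Qed.

Definition delete_vertex : sgraph := SGraph delete_adj_sym delete_adj_irr.

End DeleteVertex.

Section Triangle.
Variables (G : sgraph) (u : G).
Hypothesis free : ~ minor_model K23 G.
Hypothesis adju : forall v, v != u -> adj u v.
Let H := delete_vertex u.

(** The neighbours of [v] in [H] are common neighbours of [u] and [v] in [G]. *)
Lemma deg_delete (v : H) : (deg v <= 2)%N.
Proof.
apply: leq_trans (codeg_le2 free (adj_neq (adju (valP v)))).
rewrite /deg -(card_image val_inj).
apply: subset_leq_card; apply/fintype.subsetP => w /fintype.imageP[z vz ->].
by rewrite !inE adju ?(valP z) //= adj_sym; exact: vz.
Qed.

Lemma triangle (S : {set H}) (v a b : H) :
  (forall x y : H, x \in S -> adj x y -> y \in S) ->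
  (forall x : H, x \in S -> deg x = 2) ->
  v \in S -> adj v a -> adj v b -> a != b -> adj a b.
Proof.
(* Otherwise [v] lies on a cycle of length at least 4, and {v} and the rest R of
   the cycle against {a}, {b}, {u} form a K_{2,3} model. *)
move=> Scl Sdeg vS va vb nab; apply/negPn/negP => nadj.
have aS := Scl _ _ vS va; have bS := Scl _ _ vS vb.
have le2 := deg_delete.
have [a' aa' na'v] : exists2 a', adj a a' & a' != v.
  have /card_gt1P[c [d [ac ad ncd]]] : (1 < #|[pred w | adj a w]|)%N.
    by rewrite -/(deg a) Sdeg.
  have [cv|ncv] := eqVneq c v; last by exists c.
  by exists d; rewrite // -cv eq_sym.
have na'b : a' != b by apply: contraNneq nadj => <-.
have Nv z : adj v z -> z = a \/ z = b by apply: deg2_nbr.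
have Na z : adj a z -> z = v \/ z = a'.
  by apply: deg2_nbr => //; rewrite 1?adj_sym // eq_sym.
(* [R] below is the component of [a'] in the graph induced on [Q]; an edge from [R] to [b] closes a
   cycle through [v]. *)
pose Q := [set z in S | [&& z != v, z != a & z != b]].
pose eQ (x y : H) := [&& adj x y, x \in Q & y \in Q].
have a'Q : a' \in Q.
  by rewrite inE (Scl _ _ aS aa') na'v na'b eq_sym (adj_neq aa').
pose R := [set z | connect eQ a' z].
have a'R : a' \in R by rewrite inE connect0.
have RQ z : z \in R -> z \in Q.
  rewrite inE => /connectP[p]; elim/last_ind: p => [_ ->//|p y _].
  by rewrite rcons_path last_rcons => /andP[_ /and3P[_ _ ?]] ->.
have Rstep x y : x \in R -> adj x y -> y \in Q -> y \in R.
  move=> xR xy yQ; rewrite inE; move: (xR); rewrite inE => /connect_trans; apply.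
  by apply: connect1; rewrite /eQ xy yQ RQ.
have [/existsP[r /andP[rR rb]]|noR] := boolP [exists r, (r \in R) && adj r b].
  pose eR (x y : H) := [&& adj x y, x \in R & y \in R].
  have eRconn z : z \in R -> connect eR a' z.
    rewrite inE => /connectP[p]; elim/last_ind: p z => [z _ ->|p y IH z].
      exact: connect0.
    rewrite rcons_path last_rcons => /andP[pp /and3P[py pQ yQ]] ->.
    have lR : last a' p \in R by rewrite inE; apply/connectP; exists p.
    apply: connect_trans (IH _ pp erefl) _; apply: connect1.
    by rewrite /eR py lR (Rstep _ _ lR py yQ).
  have eRsym : connect_sym eR.
    by apply: sym_connect_sym => x y; rewrite /eR adj_sym [(x \in R) && _]andbC.
  have nuv (x : H) : val x != u := valP x.
  apply: free; apply: (@K23_modelI _ (val v) (val a) (val b) u (val @: R)).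
  - rewrite /= !inE !(inj_eq val_inj) !negb_or !nuv nab.
    by rewrite (adj_neq va) (adj_neq vb).
  - move=> x; rewrite !inE => hx; apply/imsetP => -[z /RQ].
    rewrite inE => /and4P[_ zv za zb] xz; move: hx; rewrite xz !(inj_eq val_inj).
    by rewrite (negPf zv) (negPf za) (negPf zb) (negPf (nuv z)).
  - move=> x; rewrite !inE => /or3P[] /eqP -> //; rewrite adj_sym; exact: adju.
  - move=> x; rewrite !inE => /or3P[] /eqP ->.
    + by exists (val a'); rewrite ?imset_f // adj_sym.
    + by exists (val r); rewrite ?imset_f.
    + by exists (val a'); rewrite ?imset_f // adj_sym adju.
  - move=> x y /imsetP[x' xR ->] /imsetP[y' yR ->].
    have : connect eR x' y' by apply: connect_trans (eRconn _ yR); rewrite eRsym eRconn.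
    apply: connect_homo => z w /and3P[zw zR wR].
    by apply: connect1; rewrite !imset_f // !andbT; exact: zw.
(* If R had no edge to [b], the single edge from [a] to [a'] would be its only edge
   leaving, and the degree sum inside R would be odd. *)
have Rdeg r : r \in R -> (\sum_(w in R) adj r w + (r == a') = 2)%N.
  move=> rR; have := RQ _ rR; rewrite inE => /and4P[rS rv ra rb].
  have inN t w : (w \in [pred w | delete_adj t w]) = delete_adj t w by [].
  rewrite -(Sdeg _ rS) /deg -sum1_card [RHS](bigID (fun w => w \in R)) /=; congr (_ + _)%N.
    rewrite big_mkcond [RHS]big_mkcond /=; apply: eq_bigr => w _.
    by rewrite inN /=; case: (delete_adj r w); case: (w \in R).
  have [->|nra'] := eqVneq r a'.
    rewrite (big_pred1 a) // => w; rewrite inN; apply/andP/eqP => [[rw wR]|->].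
      have [//|nwa] := eqVneq w a; case/negP: wR; apply: (Rstep _ _ a'R rw).
      rewrite inE nwa /= (Scl _ _ _ rw) ?(Scl _ _ aS aa') //=.
      apply/andP; split.
        apply: contraTneq rw => ->; apply/negP => h.
        have h' : adj v a' by rewrite adj_sym.
    case: (Nv _ h') => e.
          by have := adj_neq aa'; rewrite e eqxx.
        by rewrite e eqxx in na'b.
      apply: contraNneq noR => <-; by apply/existsP; exists a'; rewrite a'R.
    split; first by change (adj a' a); rewrite adj_sym.
    by apply/negP => /RQ; rewrite inE eqxx /= !andbF.
  rewrite big_pred0 // => w; rewrite inN; apply/negP => /andP[rw wR].
  case/negP: wR; apply: (Rstep _ _ rR rw); rewrite inE (Scl _ _ rS rw) /=.
  apply/and3P; split.
  - apply: contraTneq rw => ->; apply/negP => h.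
    have h' : adj v r by rewrite adj_sym.
    case: (Nv _ h') => e.
      by rewrite e eqxx in ra.
    by rewrite e eqxx in rb.
  - apply: contraTneq rw => ->; apply/negP => h.
    have h' : adj a r by rewrite adj_sym.
    case: (Na _ h') => e.
      by rewrite e eqxx in rv.
    by rewrite e eqxx in nra'.
  - by apply: contraNneq noR => <-; apply/existsP; exists r; rewrite rR.
have := handshake (fun z => z \in R).
have : (\sum_(r in R) \sum_(w in R) adj r w + 1 = #|R| * 2)%N.
  rewrite -sum_nat_const -(eq_bigr _ Rdeg) big_split /=; congr (_ + _)%N.
  rewrite (bigD1 a') //= eqxx big1 // => r /andP[_ /negPf->] //.
by move=> /(congr1 odd); rewrite oddD oddM andbF addbT => ->.
Qed.

End Triangle.

(** * Recognising [F3] *)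

(** [B] is the exceptional part of [G - u]: empty, an isolated vertex or an isolated edge. It plays
    the role of $K_s$, and the components outside it are triangles. *)
Lemma isomorphic_F3 (G : sgraph) (u : G) (B : {set delete_vertex u}) :
  ~ minor_model K23 G ->
  (forall v, v != u -> adj u v) ->
  (forall x : delete_vertex u, x \notin B -> deg x = 2) ->
  (forall x y : delete_vertex u, x \in B -> adj x y = (x != y) && (y \in B)) ->
  (#|B| < 3)%N ->
  isomorphic G (F3 #|G|).
Proof.
set H := delete_vertex u => free adju degT adjB B3.
have nB (x y : H) : x \notin B -> adj x y -> y \notin B.
  move=> xB xy; apply/negP => yB; move: (adjB y x yB).
  by rewrite adj_sym xy (negPf xB) andbF.
have tri (v a b : H) : v \notin B -> adj v a -> adj v b -> a != b -> adj a b.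
  move=> vB; apply: (@triangle G u free adju (~: B)); rewrite ?inE //.
  - by move=> x y; rewrite !inE; exact: nB.
  - by move=> x; rewrite inE => /degT; apply.
(* The classes of T are the triangles outside B. *)
pose T : rel H := fun x y => (x == y) || adj x y.
have TE : {in ~: B & &, equivalence_rel T}.
  move=> x y z xB yB zB; split; first by rewrite /T eqxx.
  have sub (a b c : H) : a \in ~: B -> T a b -> T a c -> T b c.
    rewrite inE => aB /orP[/eqP<- //|ab] /orP[/eqP<-|ac].
      by rewrite /T (adj_sym b) ab orbT.
    by rewrite /T; have [//|nbc] := eqVneq b c; rewrite (tri a).
  have Ts (a b : H) : T a b = T b a by rewrite /T eq_sym adj_sym.
  move=> xy; apply/idP/idP => h; first exact: sub xB xy h.
  by apply: sub yB _ h; rewrite Ts.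
pose P := equivalence_partition T (~: B).
have Pp : partition P (~: B) by apply: equivalence_partitionP.
have [/eqP Pc Pt _] := and3P Pp.
have pbE (x y : H) : x \notin B -> y \notin B -> (y \in pblock P x) = T x y.
  by move=> xB yB; apply: pblock_equivalence_partition => //; rewrite inE.
have Pin (x : H) : x \notin B -> pblock P x \in P.
  by move=> xB; apply: pblock_mem; rewrite Pc inE.
have pb3 (x : H) : x \notin B -> #|pblock P x| = 3.
  move=> xB; have -> : pblock P x = x |: [set y | adj x y].
    apply/setP => y; rewrite !inE eq_sym.
    have [yB|yB] := boolP (y \in B); last exact: pbE.
    have -> : (y \in pblock P x) = false.
      apply/negP => h; have : y \in cover P by apply/bigcupP; exists (pblock P x); rewrite ?Pin.
      by rewrite Pc inE yB.
    apply/esym/negbTE; rewrite negb_or (contraNneq _ xB) => [|->//].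
    by apply/negP => /(nB _ _ xB); rewrite yB.
  rewrite cardsU1 inE adj_irr cardsE; congr (_.+1); exact: degT.
have cardP : (#|P| * 3 = #|~: B|)%N.
  symmetry; apply: card_uniform_partition Pp => A /imsetP[x]; rewrite inE => xB ->.
  rewrite -(pb3 x xB); apply: eq_card => y; rewrite inE.
  have [yB|yB] := boolP (y \in B); last by rewrite pbE // inE yB.
  rewrite inE yB /=; symmetry; apply/negP => h.
  have : y \in cover P by apply/bigcupP; exists (pblock P x); rewrite ?Pin.
  by rewrite Pc inE yB.
have cardG : (#|G|.-1 = #|P| * 3 + #|B|)%N.
  by rewrite cardP addnC cardsC card_sub cardC1.
(* As [#|B| < 3], the number of triangles and [#|B|] are the quotient and the remainder modulo 3. *)
have [pE sE] : (#|P| = #|G|.-1 %/ 3 /\ #|B| = #|G|.-1 %% 3)%N.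
  by rewrite cardG divnMDl // modnMDl modn_small // divn_small // addn0.
have G0 : (0 < #|G|)%N by apply/card_gt0P; exists u.
(* The isomorphism sends a vertex to the index of its block and its position in that block. It is
   specified as a relation because the bounds for the ordinals depend on whether the vertex lies in
   [B]. *)
pose spec (x : G) (z : F3 #|G|) : Prop := match z with
  | inl _ => x = u
  | inr (inl (i, j)) => exists h : H, [/\ h \notin B, x = val h,
      i = index (pblock P h) (enum P) :> nat
      & j = index h (enum (pblock P h)) :> nat]
  | inr (inr j) => exists h : H, [/\ h \in B, x = val h & j = index h (enum B) :> nat]
  end.
have [f fP] : exists f : G -> F3 #|G|, forall x, spec x (f x).
  apply: fin_all_exists => x.
  have [->|nxu] := eqVneq x u; first by exists (inl ord0).
  pose h : H := exist (fun z => z != u) x nxu.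
  have [hB|hB] := boolP (h \in B).
    have lt : (index h (enum B) < #|G|.-1 %% 3)%N.
      by rewrite -sE cardE index_mem mem_enum.
    by exists (inr (inr (Ordinal lt))); exists h.
  have lti : (index (pblock P h) (enum P) < #|G|.-1 %/ 3)%N.
    by rewrite -pE cardE index_mem mem_enum Pin.
  have hb : h \in pblock P h by rewrite pbE // /T eqxx.
  have ltj : (index h (enum (pblock P h)) < 3)%N.
    by rewrite -(pb3 h hB) cardE index_mem mem_enum.
  by exists (inr (inl (Ordinal lti, Ordinal ltj))); exists h.
have idx_inj (K : finType) (A : {set K}) (a b : K) :
    a \in A -> b \in A -> index a (enum A) = index b (enum A) -> a = b.
  move=> aA bA e; rewrite -(@nth_index _ a a (enum A)) ?mem_enum //.
  by rewrite e nth_index ?mem_enum.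
have blockE (h k : H) : h \notin B -> k \notin B ->
    (index (pblock P h) (enum P) == index (pblock P k) (enum P)) = T h k.
  move=> hB kB; have kc : k \in cover P by rewrite Pc inE.
  rewrite -(pbE h k) // -(eq_pblock _ Pt) ?Pc ?inE //.
  apply/eqP/eqP => [|-> //]; apply: idx_inj; exact: Pin.
have in_block (h : H) : h \notin B -> h \in pblock P h.
  by move=> hB; rewrite pbE // /T eqxx.
have spec_inj x y z : spec x z -> spec y z -> x = y.
  case: z => [i -> -> //|[[i j]|j]] /=.
    move=> [h [hB -> ih jh]] [k [kB -> ik jk]]; congr val.
    have hk : T h k by rewrite -blockE // -ih -ik.
    have be : pblock P h = pblock P k by apply/eqP; rewrite (eq_pblock _ Pt) ?pbE // Pc inE.
    apply: (idx_inj _ (pblock P h)); rewrite ?in_block //.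
      by rewrite pbE.
    by rewrite -jh jk be.
  move=> [h [hB -> jh]] [k [kB -> jk]]; congr val.
  by apply: (idx_inj _ B); rewrite // -jh -jk.
have finj : injective f.
  by move=> x y e; apply: spec_inj (fP x) _; rewrite e; exact: fP.
exists f.
  apply: inj_card_bij finj _.
  rewrite !card_sum card_prod !card_ord -(divn_eq #|G|.-1 3).
  by rewrite add1n prednK.
move=> x y.
have valK2 (h k : H) : adj (val h) (val k) = adj h k by [].
case: (f x) (f y) (fP x) (fP y) => [i|[[i j]|j]] [i'|[[i' j']|j']] /=.
- by move=> -> ->; rewrite adj_irr (ord1 i) (ord1 i') /complete_adj eqxx.
- by move=> -> [h [_ -> _ _]]; rewrite adju ?(valP h).
- by move=> -> [h [_ -> _]]; rewrite adju ?(valP h).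
- by move=> [h [_ -> _ _]] ->; rewrite adj_sym adju ?(valP h).
- move=> [h [hB -> ih jh]] [k [kB -> ik jk]].
  rewrite /copies_adj /= /complete_adj -!val_eqE /=.
  rewrite ih ik jh jk blockE // valK2.
  have [->|nhk] := eqVneq h k; first by rewrite eqxx andbF adj_irr.
  have [hk|nhk'] := boolP (T h k); last first.
    by apply/esym/negbTE; apply: contra nhk' => hk; rewrite /T hk orbT.
  have be : pblock P h = pblock P k by apply/eqP; rewrite (eq_pblock _ Pt) ?pbE // Pc inE.
  have -> : adj (h : H) k by move: hk; rewrite /T (negPf nhk).
  apply: contraNneq nhk => e; apply/eqP/(idx_inj _ (pblock P h)); rewrite ?in_block //.
    by rewrite pbE.
  by rewrite e be.
- move=> [h [hB -> ih jh]] [k [kB -> _]]; apply/esym/negbTE/negP; rewrite valK2.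
  by move/(nB _ _ hB); rewrite kB.
- by move=> [h [_ -> _]] ->; rewrite adj_sym adju ?(valP h).
- move=> [h [hB -> _]] [k [kB -> ik jk]]; apply/esym/negbTE/negP; rewrite valK2.
  by rewrite adj_sym => /(nB _ _ kB); rewrite hB.
- move=> [h [hB -> jh]] [k [kB -> jk]]; rewrite valK2 adjB // kB andbT.
  rewrite /complete_adj -val_eqE /= jh jk; congr (~~ _).
  by apply/eqP/eqP => [|-> //]; apply: idx_inj.
Qed.

From mathcomp Require Import boolp classical_sets reals.

Import Order.TTheory GRing.Theory Num.Theory.
Local Open Scope ring_scope.

(** * Eigenvalues *)

Section Eigen.
Variable (R : realType) (G : sgraph).

Lemma sum_adj_val (y : G -> R) (v : G) :
  \sum_(i < #|G|) y (enum_val i) * (adj (enum_val i) v)%:R =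
  \sum_(w | adj v w) y w.
Proof.
rewrite [RHS]big_mkcond (reindex (@enum_val G G)) /=; last first.
  exact: onW_bij (enum_val_bij _).
by apply: eq_bigr => i _; rewrite adj_sym; case: ifP; rewrite ?mulr1 ?mulr0.
Qed.

Lemma eigenvalue_adjI (y : G -> R) (a : R) (u : G) : y u != 0 ->
  (forall v, \sum_(w | adj v w) y w = a * y v) -> eigenvalue (adjmx R G) a.
Proof.
move=> yu ye; apply/eigenvalueP; exists (\row_i y (enum_val i)).
  apply/rowP => j; rewrite !mxE -ye -sum_adj_val.
  by apply: eq_bigr => i _; rewrite !mxE.
apply: contraNneq yu => /rowP/(_ (enum_rank u)).
by rewrite !mxE enum_rankK => ->.
Qed.

(** By the triangle inequality the absolute values of an eigenvector satisfy the inequality; they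
    are then divided by their maximum, attained at [u]. *)
Lemma eigenvalue_adjE (a : R) : eigenvalue (adjmx R G) a ->
  exists (x : G -> R) (u : G), [/\ x u = 1, forall v, 0 <= x v <= 1
    & forall v, a * x v <= \sum_(w | adj v w) x w].
Proof.
case/eigenvalueP => z ze nz.
pose y v := `|z 0 (enum_rank v)|.
have y0 v : 0 <= y v by exact: normr_ge0.
have ye v : a * y v <= \sum_(w | adj v w) y w.
  rewrite -sum_adj_val.
  apply: le_trans (_ : `|(a *: z) 0 (enum_rank v)| <= _).
    by rewrite mxE normrM; apply: ler_wpM2r; rewrite ?normr_ge0 ?real_ler_norm ?num_real.
  rewrite -ze mxE; apply: le_trans (ler_norm_sum _ _ _) _.
  apply: ler_sum => i _; rewrite mxE enum_rankK normrM /y enum_valK.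
  by rewrite [X in _ * X]ger0_norm.
have [i0 zi0] : exists i, z 0 i != 0 by apply/rV0Pn.
pose u := [arg max_(v > enum_val i0) y v]%O.
have yu v : y v <= y u by rewrite /u; case: arg_maxP => // v0 _; apply.
have u0 : 0 < y u.
  by apply: lt_le_trans (yu (enum_val i0)); rewrite /y enum_valK normr_gt0.
exists (fun v => y v / y u), u; split=> [|v|v].
- by rewrite divff // gt_eqF.
- by apply/andP; split; [apply: divr_ge0; rewrite ?y0 // ltW | rewrite ler_pdivrMr // mul1r].
- by rewrite -mulr_suml mulrA ler_pM2r // invr_gt0.
Qed.

Lemma sum_le_card (T : finType) (P : pred T) (x : T -> R) c :
  (forall v, P v -> x v <= c) -> \sum_(v | P v) x v <= c * #|P|%:R.
Proof.
move=> h; apply: le_trans (ler_sum _ h) _.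
by rewrite sumr_const mulr_natr.
Qed.

(** This bounds the set whose supremum is [spectral_radius]. *)
Lemma eigenvalue_adj_bound (a : R) : eigenvalue (adjmx R G) a -> a <= #|G|%:R.
Proof.
move/eigenvalue_adjE => [x [u [xu x01 /(_ u)]]]; rewrite xu mulr1 => /le_trans; apply.
apply: le_trans (_ : 1 * #|[pred w | adj u w]|%:R <= _).
  by apply: (@sum_le_card _ (adj u)) => v _; case/andP: (x01 v).
by rewrite mul1r ler_nat max_card.
Qed.

Local Open Scope classical_set_scope.

Lemma eigenvalue_le_spectral_radius (a : R) :
  eigenvalue (adjmx R G) a -> a <= spectral_radius R G.
Proof.
move=> ha; apply: ub_le_sup => //; exists #|G|%:R => b /=.
exact: eigenvalue_adj_bound.
Qed.

End Eigen.

Lemma roots_seq (F : fieldType) (p : {poly F}) : p != 0 ->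
  exists s : seq F, forall x, root p x -> x \in s.
Proof.
have [k] := ubnP (size p); elim: k p => // k IH p; rewrite ltnS => pk p0.
have [[x px]|no] := pselect (exists x, root p x); last first.
  by exists [::] => x px; case: no; exists x.
have /factor_theorem[q pq] := px.
have q0 : q != 0 by apply: contraNneq p0 => q0; rewrite pq q0 mul0r.
have [|//|s hs] := IH q.
  apply: leq_trans pk; rewrite pq size_Mmonic ?monicXsubC // size_XsubC addn2 //.
exists (x :: s) => y; rewrite pq rootM root_XsubC inE orbC => /orP[->//|/hs->].
by rewrite orbT.
Qed.

(** A supremum of numbers below [l] could equal [l]; finiteness of the spectrum excludes this. *)
Lemma spectral_radius_lt (R : realType) (G : sgraph) (l : R) : 0 < l ->
  (forall a, eigenvalue (adjmx R G) a -> a < l) -> spectral_radius R G < l.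
Proof.
move=> l0 h.
have [s hs] := roots_seq (monic_neq0 (char_poly_monic (adjmx R G))).
(* The initial value 0 is below [l] by assumption, and it also covers an empty spectrum, whose
   supremum is 0 by convention. *)
pose b := \big[Num.max/0]_(i <- s | i < l) i.
have bl : b < l by rewrite /b; elim/big_ind: _ => // x y xl yl; rewrite gt_max xl.
apply: le_lt_trans bl.
have ub a : eigenvalue (adjmx R G) a -> a <= b.
  move=> /[dup] /h al; rewrite eigenvalue_root_char => /hs as_.
  exact: le_bigmax_seq.
rewrite /spectral_radius.
have [[a ha]|no] := pselect (exists a, eigenvalue (adjmx R G) a).
  by apply: ge_sup; [exists a | move=> c /ub].
rewrite (_ : mkset _ = set0)%classic; last first.
  by rewrite -subset0 => a ha; apply: no; exists a.
by rewrite sup0 bigmax_ge_id.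
Qed.

(** * The spectral radius of [F3] *)

Lemma sum_complete (R : realType) m (i : complete m) (c : R) :
  \sum_(w | adj i w) c = (m%:R - 1) * c.
Proof.
have m0 : (0 < m)%N by apply: leq_ltn_trans (ltn_ord i).
have cE : #|[pred w | adj i w]| = m.-1.
  rewrite -[in RHS](card_ord m) -(cardC1 i); apply: eq_card => w.
  by rewrite !inE eq_sym.
by rewrite sumr_const cE -[c *+ _]mulr_natl -{2}(prednK m0) -natr1 addrK.
Qed.

(** The eigenvector is 1 at the hub. The equations on a triangle and on $K_s$ force the values 1 /
    (l - 2) and 1 / (l - s + 1), and the equation at the hub is then the hypothesis with
    denominators cleared. *)
Lemma F3_eigenvalue (R : realType) (n : nat) (l : R) :
  let p := (n.-1 %/ 3)%N in let s := (n.-1 %% 3)%N in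
  2 < l ->
  l * (l - 2) * (l - s%:R + 1) = 3 * p%:R * (l - s%:R + 1) + s%:R * (l - 2) ->
  eigenvalue (adjmx R (F3 n)) l.
Proof.
move=> p s l2 ls.
have s2 : (s%:R : R) <= 2 by rewrite ler_nat -ltnS ltn_mod.
have ls0 : l - s%:R + 1 != 0 by apply/eqP; lra.
have l20 : l - 2 != 0 by apply/eqP; lra.
pose y (v : F3 n) : R := match v with
  | inl _ => 1 | inr (inl _) => (l - 2)^-1 | inr (inr _) => (l - s%:R + 1)^-1 end.
apply: (@eigenvalue_adjI _ _ y l (inl ord0)); first exact: oner_neq0.
have tot : \sum_(w | adj (inl ord0 : F3 n) w) y w = l.
  rewrite big_sumType /= big_pred0 ?add0r; last by move=> i; rewrite (ord1 i).
  rewrite big_sumType /= !sumr_const card_prod !card_ord.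
  rewrite -/p -/s -[_ *+ (p * 3)]mulr_natr -[_ *+ s]mulr_natr natrM.
  apply: (@mulIf _ ((l - 2) * (l - s%:R + 1))); first exact: mulf_neq0.
  by rewrite [RHS]mulrA ls; field; rewrite l20 ls0.
case=> [i|[[i j]|j]].
- by rewrite (ord1 i) tot mulr1.
- rewrite big_sumType /= big_ord1 big_sumType /= big_pred0_eq addr0.
  rewrite (eq_bigl (fun w : 'I_p * complete 3 => (i == w.1) && adj j w.2)) //.
  rewrite -(pair_big (fun k => i == k) (fun k => adj j k) (fun _ _ => (l - 2)^-1)) /=.
  by rewrite (big_pred1 i) ?sum_complete; [field | move=> k; rewrite eq_sym].
- rewrite big_sumType /= big_ord1 big_sumType /= big_pred0_eq add0r.
  rewrite sum_complete; by field.
Qed.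

(* With S = s and P = p for n - 1 = 3 p + s, this is the characteristic equation
   l = 3 p / (l - 2) + s / (l - s + 1) of the quotient of F3 n by its hub, its
   triangles and its K_s. *)
Lemma F3_root (R : realType) (P S : R) :
  200 * 200 <= 3 * P + S -> 0 <= S <= 2 ->
  exists2 l : R, 200 <= l &
    l * (l - 2) * (l - S + 1) = 3 * P * (l - S + 1) + S * (l - 2).
Proof.
move=> N4 /andP[s0 s2].
pose q : {poly R} := 'X * ('X - 2%:P) * ('X - S%:P + 1)
  - (3 * P)%:P * ('X - S%:P + 1) - S%:P * ('X - 2%:P).
have qE t : q.[t] = t * (t - 2) * (t - S + 1) - 3 * P * (t - S + 1) - S * (t - 2).
  by rewrite /q !hornerE.
(* With N = 3 P + S, [q] is negative at 200 because 3 P >= 200 * 200 - 2 > 200 * 198, and its value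
   at N is (N (N - 2) - N) (N - S + 1) + S (3 - S) >= 0. *)
have [||l /andP[l1 l2] /eqP] := @poly_ivt _ q 200 (3 * P + S).
- lra.
- rewrite !qE; apply/andP; split.
    have : 0 <= (3 * P - 200 * 198) * (200 - S + 1) by apply: mulr_ge0; lra.
    nra.
  set N := 3 * P + S.
  have -> : 3 * P = N - S by rewrite /N; lra.
  have : 0 <= (N * (N - 2) - N) * (N - S + 1).
    apply: mulr_ge0; rewrite /N; nra.
  rewrite /N; nra.
rewrite qE => ql; exists l => //; lra.
Qed.


(** The characteristic equation reads l (l - 2) = n - 1 - s (3 - s) / (l - s + 1). The last term is
    0, 2 / l or 2 / (l - 1) for s = 0, 1, 2. *)
Lemma F3_spectral_radius_ge (R : realType) (n : nat) : (200 * 200 < n)%N ->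
  exists l : R, [/\ 200 <= l, l <= spectral_radius R (F3 n)
    & n.-1%:R - 2 / (l - 1) <= l * (l - 2)].
Proof.
move=> n4.
pose P : R := (n.-1 %/ 3)%:R; pose S : R := (n.-1 %% 3)%:R.
have NE : n.-1%:R = 3 * P + S.
  by rewrite [in LHS](divn_eq n.-1 3) natrD natrM mulrC.
have N4 : 200 * 200 <= 3 * P + S.
  rewrite -NE -natrM ler_nat -ltnS prednK //; exact: leq_ltn_trans n4.
have hS : [\/ S = 0, S = 1 | S = 2].
  rewrite /S; case: (n.-1 %% 3)%N (ltn_pmod n.-1 (isT : 0 < 3)%N) => [|[|[|//]]] _.
  - by constructor 1.
  - by constructor 2.
  - by constructor 3.
have S02 : 0 <= S <= 2 by apply/andP; case: hS => ->; split; lra.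
have [l l200 le] := F3_root N4 S02.
case/andP: S02 => S0 S2.
exists l; split=> //.
  apply: eigenvalue_le_spectral_radius; apply: F3_eigenvalue le; lra.
have l0 : 0 < l - S + 1 by lra.
have l1 : 0 < l - 1 by lra.
have -> : l * (l - 2) = 3 * P + S - S * (3 - S) / (l - S + 1).
  apply: (@mulIf _ (l - S + 1)); first by rewrite gt_eqF.
  by rewrite mulrBl mulfVK ?gt_eqF // le; ring.
rewrite NE lerD2l lerN2 ler_pdivrMr // mulrAC ler_pdivlMr //.
by case: hS => ->; lra.
Qed.

(** * A graph with large spectral radius has a dominating vertex *)

Section Dominating.
Variables (R : realType) (G : sgraph) (l : R) (x : G -> R) (u : G).
Hypothesis free : ~ minor_model K23 G.
Hypothesis l200 : 200 <= l.
Hypothesis lG : #|G|.-1%:R - 2 / (l - 1) <= l * (l - 2).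
Hypothesis xu : x u = 1.
Hypothesis x01 : forall v, 0 <= x v <= 1.
Hypothesis xsub : forall v, l * x v <= \sum_(w | adj v w) x w.

Let x0 v : 0 <= x v. Proof. by case/andP: (x01 v). Qed.
Let x1 v : x v <= 1. Proof. by case/andP: (x01 v). Qed.
Let l0 : 0 <= l. Proof. by apply: le_trans l200; rewrite ler0n. Qed.
Let X := \sum_v x v.

Lemma sum_sum_adj (P : pred G) :
  \sum_(w | P w) \sum_(z | adj w z) x z =
  \sum_z #|[pred w | P w & adj w z]|%:R * x z.
Proof.
rewrite (exchange_big_dep predT) //=; apply: eq_bigr => z _.
by rewrite sumr_const mulr_natl; congr (_ *+ _); apply: eq_card => w; rewrite !inE.
Qed.

Lemma sum_sub (P : pred G) :
  l * \sum_(w | P w) x w <= \sum_z #|[pred w | P w & adj w z]|%:R * x z.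
Proof. by rewrite -sum_sum_adj mulr_sumr; apply: ler_sum => w _; apply: xsub. Qed.

(** The inequality is applied twice: the square of the adjacency matrix has the degrees on its
    diagonal and entries at most 2 elsewhere. *)
Lemma two_walks v : l * (l * x v) <= (deg v)%:R * x v + 2 * (X - x v).
Proof.
apply: le_trans (_ : l * \sum_(w | adj v w) x w <= _).
  by apply: ler_wpM2l.
apply: le_trans (sum_sub (adj v)) _.
rewrite (bigD1 v) //= /X [\sum_w x w](bigD1 v) //=.
rewrite [x v + _]addrC addrK.
have -> : #|[pred w | adj v w & adj w v]| = deg v.
  by apply: eq_card => w; rewrite !inE (adj_sym w) andbb.
rewrite lerD2l mulr_sumr; apply: ler_sum => z nz.
by rewrite ler_wpM2r // ler_nat; apply: codeg_le2; rewrite // eq_sym.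
Qed.

(** Summing [xsub] over all vertices and using [x <= 1] leaves the number of arcs. *)
Lemma mass_bound : l * X <= 6 * #|G|.-1%:R.
Proof.
apply: le_trans (_ : \sum_v \sum_(w | adj v w) 1 <= _).
  rewrite mulr_sumr; apply: ler_sum => v _; apply: le_trans (xsub v) _.
  by apply: ler_sum => w _.
have := arcs_bound free; rewrite -(ler_nat R) natrM; apply: le_trans.
rewrite /arcs natr_sum; apply: ler_sum => v _.
rewrite natr_sum big_mkcond; apply: ler_sum => w _.
by case: (adj v w).
Qed.

Let W := [set w | (w != u) && ~~ adj u w].

Lemma card_nonadj : (deg u + #|W| = #|G|.-1)%N.
Proof.
rewrite -(cardC1 u) -[RHS](cardID [pred w | adj u w]); congr (_ + _)%N.
  apply: eq_card => w; rewrite !inE.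
  by case uw: (adj u w); rewrite ?andbF // eq_sym adj_neq.
by apply: eq_card => w; rewrite !inE andbC.
Qed.

(** A neighbour of [v] is [u], one of at most two common neighbours with [u], or a member of [W]. *)
Lemma deg_le v : v != u -> (deg v <= #|W| + 3)%N.
Proof.
move=> nvu; rewrite addnC.
have c2 : (codeg u v <= 2)%N by apply: codeg_le2; rewrite // eq_sym.
have h : [pred w | adj v w] \subset [set u] :|: ([set w | adj u w & adj w v] :|: W).
  apply/fintype.subsetP => w; rewrite !inE => vw.
  by rewrite (adj_sym w) vw andbT; case: eqP => //=; case: (adj u w).
apply: leq_trans (subset_leq_card h) _.
apply: leq_trans (leq_card_setU _ _) _; rewrite cards1.
have := (leq_card_setU [set w | adj u w & adj w v] W).1.
rewrite [#|finset _|]cardsE -/(codeg u v); lia.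
Qed.

Lemma nonadj_empty : W = finset.set0.
Proof.
have l2 := l200; have lG' := lG.
set m := #|W|.
have mE : (deg u)%:R + m%:R = #|G|.-1%:R :> R by rewrite -natrD card_nonadj.
have m0 : 0 <= m%:R :> R by rewrite ler0n.
have D : 2 / (l - 1) <= 2 / 199.
  by rewrite ler_pM2l // lef_pV2 ?posrE; lra.
(* Dividing 6 (n - 1) <= 6 l (l - 2) + 12 / 199 by [l] gives 6 l - 12 plus a remainder far below
   1. *)
have XB : X <= 6 * l - 11.
  rewrite -(@ler_pM2l _ l); last lra.
  apply: le_trans mass_bound _; nra.
(* This reads l^2 <= deg u + 2 (X - 1); inserting deg u = n - 1 - m and the bound on [X] bounds
   [m]. *)
have tw := two_walks u; rewrite xu !mulr1 in tw.
have mB : m%:R <= 10 * l - 23 by lra.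
(* With deg v <= 10 l - 20, [two_walks] gives (l - 10) x v <= 12, and l - 10 >= 190. *)
have xB v : v != u -> x v <= 12 / 190.
  move=> nvu.
  have := two_walks v.
  have : (deg v)%:R <= 10 * l - 20.
    have := deg_le nvu; rewrite -(ler_nat R) natrD -/m; lra.
  have := x0 v.
  set d := (deg v)%:R; set y := x v => y0 dB tv.
  have : d * y <= (10 * l - 20) * y by rewrite ler_wpM2r.
  move=> dy.
  have : l * ((l - 10) * y) <= l * 12 by nra.
  rewrite ler_pM2l; last lra.
  nra.
pose Y := \sum_(w | adj u w) x w.
have lY : l <= Y by have := xsub u; rewrite xu mulr1.
have WB : \sum_(w in W) x w <= 12 / 190 * m%:R.
  apply: sum_le_card => w; rewrite inE => /andP[/xB] //.
(* A vertex other than [u] has at most two neighbours among those of [u]. *)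
have key : l * Y <= (deg u)%:R + 2 * Y + 2 * \sum_(w in W) x w.
  apply: le_trans (sum_sub (adj u)) _.
  rewrite (bigD1 u) //= xu mulr1 -addrA; apply: lerD.
    by rewrite ler_nat; apply: subset_leq_card; apply/fintype.subsetP => w; rewrite !inE => /andP[].
  rewrite (bigID (adj u)) /= !mulr_sumr; apply: lerD.
    rewrite [leRHS](eq_bigl (fun z => (z != u) && adj u z)); last first.
      by move=> z; case uz: (adj u z); rewrite ?andbF ?andbT // eq_sym adj_neq.
    apply: ler_sum => z /andP[nz _]; rewrite ler_wpM2r // ler_nat.
    by apply: codeg_le2; rewrite // eq_sym.
  rewrite [leRHS](eq_bigl (fun z => (z != u) && ~~ adj u z)); last first.
    by move=> z; rewrite !inE.
  apply: ler_sum => z /andP[nz _]; rewrite ler_wpM2r // ler_nat.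
  by apply: codeg_le2; rewrite // eq_sym.
(* A non-neighbour lowers deg u by 1 but contributes at most 24 / 190 to the right side of [key].
   Hence (1 - 24 / 190) m <= 2 / 199, and the integer [m] is 0. *)
apply/eqP; rewrite -cards_eq0 -/m -leqn0 -ltnS -(ltr_nat R).
have : (l - 2) * l <= (l - 2) * Y by apply: ler_wpM2l; lra.
lra.
Qed.

Lemma adj_max v : v != u -> adj u v.
Proof.
move=> nv; have := finset.in_set0 v; rewrite -nonadj_empty inE nv /=.
by case: (adj u v).
Qed.

End Dominating.

(** * The graph around the dominating vertex *)

Section Deg2.
Variables (R : realType) (H : sgraph) (l : R).
Hypothesis deg2 : forall v : H, (deg v <= 2)%N.
Hypothesis l2 : 2 < l.

Let deg_lt (v : H) : 0 < l - (deg v)%:R.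
Proof. by rewrite subr_gt0 (le_lt_trans _ l2) // ler_nat deg2. Qed.

(** An eigenvalue is at most the maximum degree, so [l] is none and [A - l] is invertible. The
    right-hand side -1 below matches the sign of [M]. *)
Lemma resolvent : exists y : H -> R, forall v, l * y v = 1 + \sum_(w | adj v w) y w.
Proof.
pose M := adjmx R H - l%:M.
have Mu : M \in unitmx.
  rewrite -row_free_unit -kermx_eq0; apply/negPn/negP => /eigenvalue_adjE.
  case=> x [u [xu x01 /(_ u)]]; rewrite xu mulr1 => lu.
  suff : l <= (deg u)%:R by rewrite leNgt -subr_gt0 deg_lt.
  apply: le_trans lu _; rewrite -[leRHS]mul1r.
  by apply: sum_le_card => v _; case/andP: (x01 v).
have [z zM] : exists z : 'rV[R]_#|H|, z *m M = const_mx (-1).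
  by exists (const_mx (-1) *m invmx M); rewrite mulmxKV.
exists (fun v => z 0 (enum_rank v)) => v.
move/rowP/(_ (enum_rank v)): zM; rewrite mulmxBr mul_mx_scalar !mxE => e.
have <- : \sum_i z 0 i * adjmx R H i (enum_rank v) =
    \sum_(w | adj v w) z 0 (enum_rank w).
  rewrite -(sum_adj_val (fun v => z 0 (enum_rank v))); apply: eq_bigr => i _.
  by rewrite [adjmx _ _ _ _]mxE enum_rankK enum_valK.
by apply/eqP; rewrite -[1]opprK -e opprB subrK.
Qed.

(** At a vertex [v] where [y] is minimal, (l - deg v) y v >= 1. *)
Lemma resolvent_gt0 (y : H -> R) :
  (forall v, 1 + \sum_(w | adj v w) y w <= l * y v) -> forall v, 0 < y v.
Proof.
move=> hy v0.
pose v := [arg min_(v < v0) y v]%O.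
have vmin w : y v <= y w by rewrite /v; case: arg_minP => // i _; apply.
apply: lt_le_trans (vmin v0).
have : 1 + (deg v)%:R * y v <= l * y v.
  apply: le_trans (hy v); rewrite lerD2l mulr_natl -sumr_const.
  by apply: ler_sum.
rewrite -lerBrDr -mulrBl => h.
by rewrite -(pmulr_rgt0 _ (deg_lt v)); apply: lt_le_trans h.
Qed.

(** Maximum principle: where d = x - y is maximal, (l - deg v) d v <= 0. *)
Lemma resolvent_le (x y : H -> R) :
  (forall v, l * y v = 1 + \sum_(w | adj v w) y w) ->
  (forall v, l * x v <= 1 + \sum_(w | adj v w) x w) -> forall v, x v <= y v.
Proof.
move=> hy hx v0.
pose d v := x v - y v.
pose v := [arg max_(v > v0) d v]%O.
have vmax w : d w <= d v by rewrite /v; case: arg_maxP => // i _; apply.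
rewrite -subr_le0; apply: le_trans (vmax v0) _.
have : l * d v <= (deg v)%:R * d v.
  apply: le_trans (_ : \sum_(w | adj v w) d w <= _).
    by have := hx v; rewrite mulrBr hy sumrB; lra.
  by rewrite mulr_natl -sumr_const; apply: ler_sum.
by rewrite -subr_ge0 -mulrBl -opprB mulNr oppr_ge0 pmulr_rle0.
Qed.

(** In the sum of all equations each [y w] occurs [deg w] times on the right. The truncated
    subtraction is exact by [deg2]. *)
Lemma resolvent_mass (y : H -> R) :
  (forall v, l * y v = 1 + \sum_(w | adj v w) y w) ->
  (l - 2) * \sum_v y v = #|H|%:R - \sum_v (2 - deg v)%:R * y v.
Proof.
move=> hy.
have e : l * \sum_v y v = #|H|%:R + \sum_v (deg v)%:R * y v.
  rewrite mulr_sumr (eq_bigr _ (fun v _ => hy v)) big_split /= sumr_const.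
  congr (_ + _); rewrite (exchange_big_dep predT) //=; apply: eq_bigr => w _.
  rewrite sumr_const mulr_natl; congr (_ *+ _).
  by apply: eq_card => v; rewrite !inE adj_sym.
rewrite mulrBl e mulr_sumr -addrA -sumrB -sumrN; congr (_ + _).
by apply: eq_bigr => v _; rewrite natrB //; ring.
Qed.

End Deg2.

Lemma dominated_isomorphic_F3 (R : realType) (G : sgraph) (l : R) (x : G -> R)
    (u : G) :
  ~ minor_model K23 G -> (forall v, v != u -> adj u v) -> 3 < l ->
  #|G|.-1%:R - 2 / (l - 1) <= l * (l - 2) ->
  x u = 1 -> (forall v, l * x v <= \sum_(w | adj v w) x w) ->
  isomorphic G (F3 #|G|).
Proof.
move=> free adju l3 lG xu xsub.
have l2 : 2 < l by lra.
set H := delete_vertex u.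
have deg2 (v : H) : (deg v <= 2)%N by exact: deg_delete.
have cardH : #|H| = #|G|.-1 by rewrite card_sub cardC1.
have sumH (F : G -> R) : \sum_(w | w != u) F w = \sum_(w : H) F (val w).
  exact: sum_sub_neq.
have [y hy] := resolvent deg2 l2.
have y0 : forall v, 0 < y v.
  by apply: (resolvent_gt0 deg2 l2) => v; rewrite hy.
(* On [H] the vertex [u] contributes x u = 1 to each inequality, so [resolvent_le] gives x <= y
   there; the inequality at [u] then bounds [l]. *)
have lY : l <= \sum_v y v.
  have := xsub u; rewrite xu mulr1 => /le_trans; apply.
  rewrite (eq_bigl (fun w => w != u)); last first.
    move=> w; apply/idP/idP => [uw|/adju //].
    by rewrite eq_sym adj_neq.
  rewrite sumH; apply: ler_sum => v _.
  apply: (resolvent_le deg2 l2 hy (x := fun v => x (val v))) => {}v.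
  apply: le_trans (xsub (val v)) _.
  rewrite (bigD1 u) /=; last by rewrite adj_sym adju ?(valP v).
  rewrite xu lerD2l big_mkcondl /= (eq_bigl (fun w => w != u)) // sumH.
  by rewrite [leRHS]big_mkcond.
pose g (v : H) := (2 - deg v)%N.
(* Comparing l (l - 2) <= (l - 2) * sum y = n - 1 - sum g y with [lG]. *)
have gy : \sum_v (g v)%:R * y v <= 2 / (l - 1).
  have := resolvent_mass deg2 hy; rewrite cardH => mass.
  have : (l - 2) * l <= (l - 2) * \sum_v y v by rewrite ler_wpM2l // subr_ge0 ltW.
  rewrite mass; set t := 2 / (l - 1) in lG *; set s := \sum_v _.
  lra.
have l10 : 0 < l - 1 by lra.
have ly1 v : 1 <= l * y v.
  by rewrite hy lerDl sumr_ge0 // => w _; apply: ltW.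
(* A total of at least 3, with y >= 1 / l, would give 3 / l <= 2 / (l - 1), that is, l <= 3. *)
have gsum : (\sum_v g v < 3)%N.
  rewrite ltnNge; apply/negP => g3; move: gy; apply/negP; rewrite -ltNge.
  rewrite ltr_pdivrMr //.
  have : 3 <= l * \sum_v (g v)%:R * y v.
    apply: le_trans (_ : (\sum_v g v)%:R <= _); first by rewrite ler_nat.
    rewrite mulr_sumr natr_sum; apply: ler_sum => v _.
    by rewrite mulrCA ler_peMr.
  set s := \sum_v _ => ls.
  have : 3 * (l - 1) <= l * (s * (l - 1)) by rewrite mulrA ler_wpM2r // ltW.
  move=> h; rewrite -(@ltr_pM2l _ l); lra.
have geven : ~~ odd (\sum_v g v).
  have := handshake (fun _ : H => true).
  have -> : (\sum_(v : H) \sum_(w : H) adj v w = \sum_(v : H) deg v)%N.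
    apply: eq_bigr => v _; rewrite /deg -sum1_card [RHS]big_mkcond /=.
    by apply: eq_bigr => w _; rewrite inE; case: (delete_adj v w).
  have : (\sum_v g v + \sum_(v : H) deg v = #|H| * 2)%N.
    by rewrite -big_split /= -sum_nat_const; apply: eq_bigr => v _; rewrite subnK.
  move=> /(congr1 odd); rewrite oddD oddM andbF.
  by case: (odd (\sum_(v : H) deg v)) => //; rewrite addbF => ->.
have degE v : deg v = (2 - g v)%N by rewrite /g subKn.
have deg0 v : g v = 0%N -> deg v = 2 by move=> gv; rewrite degE gv.
(* The total of [g] is even and below 3. It is 0, or 2 from one isolated vertex, or 2 from two
   vertices of degree 1. *)
have [g0|[v gv]] : (forall v, g v = 0%N) \/ exists v, (0 < g v)%N.
  have [/existsP|no] := boolP [exists v, (0 < g v)%N]; first by right.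
  by left=> v; apply/eqP; move/existsPn/(_ v): no; rewrite lt0n negbK.
  apply: (@isomorphic_F3 _ u finset.set0) => //.
  - by move=> z _; apply: deg0.
  - by move=> z t; rewrite finset.in_set0.
  - by rewrite cards0.
have sE : (\sum_i g i = g v + \sum_(i | i != v) g i)%N by rewrite (bigD1 v).
have [gv2|gv1] : g v = 2 \/ g v = 1%N.
  have : (g v <= 2)%N by rewrite leq_subr.
  by case: (g v) gv => [//|[|[|//]]]; auto.
  have rest z : z != v -> g z = 0%N.
    move=> nz; have : (\sum_(i | i != v) g i = 0)%N by move: gsum; rewrite sE gv2; lia.
    by move/eqP; rewrite sum_nat_eq0 => /forallP/(_ z); rewrite nz => /eqP.
  have dv : deg v = 0%N by rewrite degE gv2.
  apply: (@isomorphic_F3 _ u [set v]) => //.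
  - by move=> z; rewrite finset.in_set1 => /rest/deg0.
  - move=> z t /finset.set1P->; rewrite finset.in_set1 [t == v]eq_sym andNb.
    by apply/negbTE/negP => vt; move: (card0_eq dv t); rewrite inE vt.
  - by rewrite cards1.
have s1 : (\sum_(i | i != v) g i = 1)%N.
  move: gsum geven; rewrite sE gv1 add1n /=; case: (\sum_(i | i != v) g i)%N => [|[|k]] //.
have [w nwv gw] : exists2 w, w != v & (0 < g w)%N.
  have [/exists_inP[w nw gw]|no] := boolP [exists w, (w != v) && (0 < g w)%N].
    by exists w.
  suff : (\sum_(i | i != v) g i = 0)%N by rewrite s1.
  apply: big1 => i ni; apply/eqP; move/existsPn/(_ i): no; rewrite ni lt0n negbK //.
have s2 : (\sum_(i | i != v) g i =
           g w + \sum_(i | (i != v) && (i != w)) g i)%N by rewrite (bigD1 w).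
rewrite s1 in s2.
have gw1 : g w = 1%N by lia.
have rest z : z != v -> z != w -> g z = 0%N.
  move=> nzv nzw.
  have : (\sum_(i | (i != v) && (i != w)) g i = 0)%N by lia.
  by move/eqP; rewrite sum_nat_eq0 => /forallP/(_ z); rewrite nzv nzw => /eqP.
have dv : deg v = 1%N by rewrite degE gv1.
have dw : deg w = 1%N by rewrite degE gw1.
have one (a b c : H) : deg a = 1%N -> adj a b -> adj a c -> b = c.
  move=> da ab ac; apply/eqP; apply: contraT => nbc.
  suff : (1 < #|[pred w | adj a w]|)%N by rewrite -/(deg a) da.
  by apply/card_gt1P; exists b, c.
have [vw|nvw] := boolP (adj v w).
  apply: (@isomorphic_F3 _ u [set v; w]) => //.
  - by move=> z; rewrite finset.in_set2 negb_or => /andP[zv zw]; apply/deg0/rest.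
  - have wv : adj w v by rewrite adj_sym.
    move=> z t /finset.set2P[]->; rewrite finset.in_set2.
      apply/idP/idP => [vt|/andP[nvt /orP[/eqP tv|/eqP->//]]].
        by rewrite adj_neq //= (one _ _ _ dv vt vw) eqxx orbT.
      by rewrite tv eqxx in nvt.
    apply/idP/idP => [wt|/andP[nvt /orP[/eqP->//|/eqP tw]]].
      by rewrite adj_neq //= (one _ _ _ dw wt wv) eqxx.
    by rewrite tw eqxx in nvt.
  - by rewrite cards2 eq_sym nwv.
(* For two nonadjacent vertices of degree 1, both values of [y] exceed the value
   [1 / (l - 1)] that [y] takes on an isolated edge. *)
have big (a b : H) : deg a = 1%N -> adj a b -> deg b = 2 -> 1 / (l - 1) < y a.
  move=> da ab db; rewrite ltr_pdivrMr //.
  have ha : 1 + y b <= l * y a.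
    rewrite hy lerD2l (bigD1 b) //= lerDl sumr_ge0 // => z _; exact: ltW.
  have [c bc nca] : exists2 c, adj b c & c != a.
    have /card_gt1P[c [d [bc bd ncd]]] : (1 < #|[pred w | adj b w]|)%N.
      by rewrite -/(deg b) db.
    have [ca|nca] := eqVneq c a; last by exists c.
    by exists d; rewrite // -ca eq_sym.
  have hb : 1 + y a < l * y b.
    rewrite hy ltrD2l (bigD1 a) ?(adj_sym b) //= ltrDl.
    rewrite (bigD1 c) /=; last by rewrite nca andbT; exact: bc.
    by apply: ltr_pwDl; rewrite ?y0 // sumr_ge0 // => z _; exact: ltW.
  (* Eliminating [y b] from [ha] and [hb] gives l + 1 < (l^2 - 1) y a, from which the factor l + 1
     cancels. Strictness comes from the second neighbour [c] of [b]. *)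
  have la : 0 < l + 1 by lra.
  rewrite -(ltr_pM2l la).
  have : l * (1 + y b) <= l * (l * y a) by apply: ler_wpM2l; lra.
  lra.
have nbr (a : H) : deg a = 1%N -> exists b, adj a b.
  by move=> da; have /card_gt0P[b ab] : (0 < #|[pred w | adj a w]|)%N;
     [rewrite -/(deg a) da | exists b].
have [v' vv'] := nbr _ dv; have [w' ww'] := nbr _ dw.
have dv' : deg v' = 2.
  apply/deg0/rest; first by rewrite eq_sym adj_neq.
  by apply: contraNneq nvw => <-.
have dw' : deg w' = 2.
  apply/deg0/rest; last by rewrite eq_sym adj_neq.
  by apply: contraNneq nvw => <-; rewrite adj_sym.
have bv := big _ _ dv vv' dv'; have bw := big _ _ dw ww' dw'.
exfalso; move: gy; apply/negP; rewrite -ltNge.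
rewrite (bigD1 v) //= (bigD1 w) //= gv1 gw1 !mul1r.
have r0 : 0 <= \sum_(i | (i != v) && (i != w)) (g i)%:R * y i.
  by apply: sumr_ge0 => z _; rewrite mulr_ge0 // ltW.
have -> : 2 / (l - 1) = 1 / (l - 1) + 1 / (l - 1) by rewrite -mulrDl.
by rewrite addrA -[ltLHS]addr0; apply: ltr_leD r0; apply: ltrD.
Qed.

Theorem theorem2 (R : realType) (n : nat) (G : sgraph) :
  (40 * 1000 < n)%N ->
  #|G| = n ->
  ~ minor (complete_bipartite 2 3) G ->
  ~ isomorphic G (F3 n) ->
  (spectral_radius R G < spectral_radius R (F3 n))%R.
Proof.
move=> n4 cG nominor niso.
have free : ~ minor_model K23 G by move/minor_model_minor.
have n4' : (200 * 200 < n)%N by lia.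
have [l [l200 lF lG]] := F3_spectral_radius_ge R n4'.
apply: lt_le_trans lF; apply: spectral_radius_lt; first lra.
move=> a ha; rewrite ltNge; apply/negP => la; apply: niso.
have [x [u [xu x01 xsub]]] := eigenvalue_adjE ha.
(* As [x] is nonnegative, the inequality for [a] passes to the smaller [l], to which the estimate
   [lG] applies. *)
have lsub v : l * x v <= \sum_(w | adj v w) x w.
  apply: le_trans (xsub v); apply: ler_wpM2r => //.
  by case/andP: (x01 v).
rewrite -cG in lG *; have l3 : 3 < l by lra.
apply: (dominated_isomorphic_F3 free _ l3 lG xu lsub) => v.
exact: (adj_max free l200 lG xu x01 lsub).
Qed.
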